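(* Let $P$ be a polytope that is neither empty nor a point, with slack matrix $S=S(P)$. If there exists a randomized protocol of complexity $c$ computing $S$ in expectation, then $\operatorname{xc}(P)\leqslant 2^c$. Conversely, if $\operatorname{xc}(P)=r$, then there exists a randomized protocol computing $S$ in expectation whose complexity is at most $\lceil\lg r\rceil$. In other words, if $c_{\min}(S)$ denotes the minimum complexity of a randomized protocol computing $S$ in expectation, then $$c_{\min}(S(P))=\lceil\lg \operatorname{xc}(P)\rceil .$$
   Context: $\lg$ is the base-2 logarithm. An extension of a polytope $P\subseteq\mathbb{R}^d$ is a polyhedron $Q\subseteq\mathbb{R}^e$ together with a linear map $\pi:\mathbb{R}^e\to\mathbb{R}^d$ with $\pi(Q)=P$; its size is the number of facets of $Q$. The extension complexity $\operatorname{xc}(P)$ is the minimum size of an extension of $P$. If $h_1(x)\geqslant 0,\dots,h_m(x)\geqslant 0$ ($h_i$ affine) are the facet-defining inequalities of $P$ (one per facet, each fixed up to positive scaling) and $v_1,\dots,v_n$ are the vertices of $P$, the slack matrix of $P$ is the nonnegative $m\times n$ matrix $S(P)$ with entries $h_i(v_j)$. Randomized protocols (with private random bits and nonnegative outputs). Let $X,Y$ be finite sets (for an $m\times n$ matrix, $X=[m]$, $Y=[n]$). A randomized protocol is a rooted binary tree in which each node has a type, $X$ or $Y$. Each internal node $v$ of type $X$ carries functions $p_{0,v},p_{1,v}:X\to[0,1]$ with $p_{0,v}(x)+p_{1,v}(x)\leqslant 1$ for all $x$; each internal node $v$ of type $Y$ carries functions $q_{0,v},q_{1,v}:Y\to[0,1]$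 with $q_{0,v}(y)+q_{1,v}(y)\leqslant 1$ for all $y$. Each leaf $v$ of type $X$ carries a nonnegative vector $\Lambda_v\in\mathbb{R}_+^X$, and each leaf $v$ of type $Y$ a nonnegative vector $\Lambda_v\in\mathbb{R}_+^Y$. An execution on input $(x,y)\in X\times Y$ is a random path starting at the root: at an internal node $v$ of type $X$ it goes to the left child with probability $p_{0,v}(x)$, to the right child with probability $p_{1,v}(x)$, and stops at $v$ with the remaining probability; at an internal node of type $Y$ it does the same with $q_{0,v}(y),q_{1,v}(y)$ (choices at different nodes being independent). The value of an execution stopping at a leaf $v$ is $\Lambda_v(x)$ if $v$ has type $X$ and $\Lambda_v(y)$ if $v$ has type $Y$; the value of an execution stopping at an internal node is $0$. The protocol computes a matrix $S\in\mathbb{R}_+^{X\times Y}$ in expectation if for every $(x,y)$ the expected value of an execution on $(x,y)$ equals $S(x,y)$. The complexity of a protocol is the height of its tree (a single node has height $0$). *)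

(* Defs.v *)
(* MathComp + MathComp-Analysis, over an arbitrary [R : realType]. *)
From HB Require Import structures.
From mathcomp Require Import all_boot all_order all_algebra.
From mathcomp Require Import all_classical all_reals all_analysis.

Set Implicit Arguments.
Unset Strict Implicit.
Unset Printing Implicit Defensive.

Import Order.TTheory GRing.Theory Num.Theory.

Local Open Scope classical_set_scope.
Local Open Scope card_scope.
Local Open Scope ring_scope.

Definition is_min (A : set nat) (k : nat) : Prop :=
  A k /\ forall j, A j -> (k <= j)%N.

Definition lg (R : realType) (x : R) : R := ln x / ln 2.

(* Points of R^d are column vectors. *)

Definition polyhedron (R : realType) (d : nat) (Q : set 'cV[R]_d) : Prop :=
  exists (k : nat) (A : 'M[R]_(k, d)) (b : 'cV[R]_k),
    Q = [set x | forall i, (A *m x) i 0 <= b i 0].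

Definition convex_hull (R : realType) (d k : nat) (p : 'I_k -> 'cV[R]_d) :
    set 'cV[R]_d :=
  [set x | exists w : 'I_k -> R,
    [/\ forall i, 0 <= w i, \sum_i w i = 1 & x = \sum_i w i *: p i]].

Definition polytope (R : realType) (d : nat) (P : set 'cV[R]_d) : Prop :=
  exists (k : nat) (p : 'I_k -> 'cV[R]_d), P = convex_hull p.

(* The pair (a, b) encodes the affine function x |-> a x + b. *)
Definition affine_fun (R : realType) (d : nat) : Type := ('rV[R]_d * R)%type.

Definition aff_eval (R : realType) (d : nat) (h : affine_fun R d)
    (x : 'cV[R]_d) : R :=
  (h.1 *m x) 0 0 + h.2.

Definition valid_on (R : realType) (d : nat) (Q : set 'cV[R]_d)
    (h : affine_fun R d) : Prop :=
  forall x, Q x -> 0 <= aff_eval h x.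

Definition tight_set (R : realType) (d : nat) (Q : set 'cV[R]_d)
    (h : affine_fun R d) : set 'cV[R]_d :=
  [set x | Q x /\ aff_eval h x = 0].

(* Taking h = 0 and h = 1 shows that Q itself and the empty set are faces. *)
Definition face (R : realType) (d : nat) (Q F : set 'cV[R]_d) : Prop :=
  exists2 h : affine_fun R d, valid_on Q h & F = tight_set Q h.

(* A facet is an inclusion-wise maximal proper face. It is required to be
   nonempty, so that affine subspaces (in particular points) have no facets. *)
Definition facet (R : realType) (d : nat) (Q F : set 'cV[R]_d) : Prop :=
  [/\ face Q F, F !=set0, F <> Q &
      forall G, face Q G -> G <> Q -> F `<=` G -> G = F].

Definition vertex (R : realType) (d : nat) (P : set 'cV[R]_d) (v : 'cV[R]_d) :
    Prop :=
  face P [set v].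

(* The order of the rows and columns and the choice of the facet-defining
   functions (positive scaling and, if P is not full-dimensional, the values
   outside of the affine hull of P) are left free, so this is a relation. *)
Definition slack_matrix (R : realType) (d : nat) (P : set 'cV[R]_d)
    (m n : nat) (S : 'M[R]_(m, n)) : Prop :=
  exists (h : 'I_m -> affine_fun R d) (v : 'I_n -> 'cV[R]_d),
    [/\ forall i, valid_on P (h i) /\ facet P (tight_set P (h i)),
        forall F, facet P F -> exists! i, F = tight_set P (h i),
        injective v,
        forall x, vertex P x <-> exists j, x = v j &
        S = \matrix_(i, j) aff_eval (h i) (v j)].

Definition extension (R : realType) (d e : nat) (P : set 'cV[R]_d)
    (Q : set 'cV[R]_e) (pi : {linear 'cV[R]_e -> 'cV[R]_d}) : Prop :=
  polyhedron Q /\ pi @` Q = P.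

Definition has_extension_of_size (R : realType) (d : nat) (P : set 'cV[R]_d)
    (k : nat) : Prop :=
  exists (e : nat) (Q : set 'cV[R]_e) (pi : {linear 'cV[R]_e -> 'cV[R]_d}),
    extension P Q pi /\ [set F | facet Q F] #= `I_k.

Definition is_xc (R : realType) (d : nat) (P : set 'cV[R]_d) (r : nat) : Prop :=
  is_min [set k | has_extension_of_size P k] r.

(* The suffix of a constructor is the type (X or Y) of the node. *)
Inductive protocol (R X Y : Type) : Type :=
| LeafX of X -> R
| LeafY of Y -> R
| NodeX of X -> R & X -> R & protocol R X Y & protocol R X Y
| NodeY of Y -> R & Y -> R & protocol R X Y & protocol R X Y.

Arguments LeafX {R X Y}.
Arguments LeafY {R X Y}.
Arguments NodeX {R X Y}.
Arguments NodeY {R X Y}.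

Definition branching (R : realType) (Z : Type) (p0 p1 : Z -> R) : Prop :=
  forall z, [/\ 0 <= p0 z <= 1, 0 <= p1 z <= 1 & p0 z + p1 z <= 1].

Fixpoint protocol_wf (R : realType) (X Y : Type) (t : protocol R X Y) : Prop :=
  match t with
  | LeafX L => forall x, 0 <= L x
  | LeafY L => forall y, 0 <= L y
  | NodeX p0 p1 l r => [/\ branching p0 p1, protocol_wf l & protocol_wf r]
  | NodeY q0 q1 l r => [/\ branching q0 q1, protocol_wf l & protocol_wf r]
  end.

Fixpoint height (R X Y : Type) (t : protocol R X Y) : nat :=
  match t with
  | LeafX _ | LeafY _ => 0%N
  | NodeX _ _ l r | NodeY _ _ l r => (maxn (height l) (height r)).+1
  end.

(* The executions on input (x, y), one for each node of the tree at which the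
   random path may stop, as pairs (probability, value). *)
Fixpoint executions (R : realType) (X Y : Type) (t : protocol R X Y)
    (x : X) (y : Y) : seq (R * R) :=
  let branch (p0 p1 : R) l r :=
    (1 - p0 - p1, 0) ::
      [seq (p0 * o.1, o.2) | o <- l] ++ [seq (p1 * o.1, o.2) | o <- r] in
  match t with
  | LeafX L => [:: (1, L x)]
  | LeafY L => [:: (1, L y)]
  | NodeX p0 p1 l r =>
      branch (p0 x) (p1 x) (executions l x y) (executions r x y)
  | NodeY q0 q1 l r =>
      branch (q0 y) (q1 y) (executions l x y) (executions r x y)
  end.

Definition expected_value (R : realType) (X Y : Type) (t : protocol R X Y)
    (x : X) (y : Y) : R :=
  \sum_(o <- executions t x y) o.1 * o.2.

Definition computes (R : realType) (m n : nat) (t : protocol R 'I_m 'I_n)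
    (S : 'M[R]_(m, n)) : Prop :=
  protocol_wf t /\ forall i j, expected_value t i j = S i j.

Definition is_cmin (R : realType) (m n : nat) (S : 'M[R]_(m, n)) (c : nat) :
    Prop :=
  is_min [set k | exists2 t : protocol R 'I_m 'I_n, computes t S & height t = k]
    c.

(* Main.v *)
(* By Yannakakis' theorem, [xc P] is the least [k] such that [S = T U] with [T],
   [U] nonnegative and inner dimension [k]: Farkas' lemma over the facets of an
   extension gives a factorization, and [{(x, y) | h x = T y, y >= 0}] turns a
   factorization into an extension. Factorizations are in turn protocols: the
   expected value is a sum, over the leaves, of products of a function of [x] and
   a function of [y]; conversely, after scaling the rows of [T] to sum to at most
   1, [T i l] can be used as the probability of reaching leaf [l] on input [i].
   The latter needs a root that is not a leaf, that is [k > 1], which holds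
   because [P] is not a point. *)
Require Import Defs.
From HB Require Import structures.
From mathcomp Require Import all_boot all_order all_algebra.
From mathcomp Require Import all_classical all_reals all_analysis.
From mathcomp Require Import ring lra zify.

Set Implicit Arguments.
Unset Strict Implicit.

Import Order.TTheory GRing.Theory Num.Theory.
Local Open Scope classical_set_scope.
Local Open Scope ring_scope.

(** * Polyhedral cones and systems of affine inequalities *)

(** The maximum of 0 and the values of [g] on [s]. Elimination uses it as the least admissible
    coefficient of the new generator. *)
Lemma finite_sup_ge0 (R : realDomainType) (T : eqType) (s : seq T) (g : T -> R) :
  exists t, [/\ 0 <= t, {in s, forall b, g b <= t} &
    t = 0 \/ exists2 b, b \in s & t = g b].
Proof.
elim: s => [|b s [t [t0 ts tE]]]; first by exists 0; split=> //; left.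
have [gt|/ltW tg] := leP (g b) t.
  exists t; split=> // [c|]; first by rewrite inE => /orP[/eqP->|/ts].
  by case: tE => [|[c cs ->]]; [left|right; exists c; rewrite ?inE ?cs ?orbT].
exists (g b); split; first exact: le_trans tg.
  by move=> c; rewrite inE => /orP[/eqP->|/ts /le_trans->].
by right; exists b; rewrite ?mem_head.
Qed.

Definition cone {R : realFieldType} {n : nat} {I : finType}
    (a : I -> 'rV[R]_n) : set 'rV[R]_n :=
  [set x | exists2 w : I -> R, forall i, 0 <= w i & x = \sum_i w i *: a i].

Definition pairing {R : realFieldType} {n : nat} (x : 'rV[R]_n)
  (b : 'cV[R]_n) : R := (x *m b) 0 0.

Lemma pairingDl (R : realFieldType) n (x y : 'rV[R]_n) b :
  pairing (x + y) b = pairing x b + pairing y b.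
Proof. by rewrite /pairing mulmxDl mxE. Qed.

Lemma pairingZl (R : realFieldType) n t (x : 'rV[R]_n) b :
  pairing (t *: x) b = t * pairing x b.
Proof. by rewrite /pairing -scalemxAl mxE. Qed.

Lemma pairing_comb (R : realFieldType) n (x : 'rV[R]_n) s t b c :
  pairing x (s *: b - t *: c) = s * pairing x b - t * pairing x c.
Proof. by rewrite /pairing mulmxBr -!scalemxAr !mxE. Qed.

Lemma pairing_sum (R : realFieldType) n (I : finType) (w : I -> R)
    (a : I -> 'rV[R]_n) b :
  pairing (\sum_i w i *: a i) b = \sum_i w i * pairing (a i) b.
Proof.
by rewrite /pairing mulmx_suml summxE; apply: eq_bigr => i _; exact: pairingZl.
Qed.

(* Fourier-Motzkin: adding a generator [a] to the cone means eliminating [t >= 0]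
   from the inequalities satisfied by [x - t a]. *)
Lemma cone_ord_polyhedral (R : realFieldType) n k (a : 'I_k -> 'rV[R]_n) :
  exists s : seq 'cV[R]_n,
    forall x, cone a x <-> {in s, forall b, 0 <= pairing x b}.
Proof.
elim: k a => [|k IHk] a.
  (* Without generators the cone is [{0}], cut out by [x_i >= 0] and [- x_i >= 0]. *)
  exists ([seq delta_mx i 0 | i <- enum 'I_n] ++
          [seq - delta_mx i 0 | i <- enum 'I_n]) => x.
  have xE i : pairing x (delta_mx i 0) = x 0 i.
    by rewrite /pairing -colE mxE.
  split=> [[w _ ->] b _|x0]; first by rewrite big_ord0 /pairing mul0mx mxE.
  exists (fun=> 0) => //; rewrite big_ord0; apply/rowP => i; rewrite mxE.
  apply/eqP; rewrite eq_le -oppr_ge0 -xE.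
  have -> : - pairing x (delta_mx i 0) = pairing x (- delta_mx i 0).
    by rewrite /pairing mulmxN [RHS]mxE.
  apply/andP; split; apply: x0; rewrite mem_cat; apply/orP.
    by right; apply/mapP; exists i; rewrite ?mem_enum.
  by left; apply/mapP; exists i; rewrite ?mem_enum.
have [s sP] := IHk (fun i => a (lift ord0 i)).
pose f b := pairing (a ord0) b.
(* Keep the inequalities that hold at the new generator, and combine each pair of opposite signs,
   with positive coefficients, so that the new generator pairs to 0. *)
exists ([seq b <- s | 0 <= f b] ++
  [seq f b *: c - f c *: b | b <- [seq b <- s | 0 < f b],
                             c <- [seq c <- s | f c < 0]]) => x; split.
  move=> [w w0 ->]; rewrite big_ord_recl.
  set y := \sum_(i < k) _.
  have /sP ys : cone (fun i => a (lift ord0 i)) y.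
    by exists (fun i => w (lift ord0 i)).
  move=> b; rewrite mem_cat => /orP[|].
    rewrite mem_filter => /andP[fb bs].
    by rewrite pairingDl pairingZl addr_ge0 ?ys ?mulr_ge0.
  move=> /allpairsP[[b1 c]] /= []; rewrite !mem_filter.
  move=> /andP[fb bs] /andP[fc cs] ->; rewrite pairing_comb !pairingDl !pairingZl.
  have := ys _ bs; have := ys _ cs; rewrite -/(f b1) -/(f c).
  by move: (w ord0) => t; nra.
move=> xs.
(* The inequalities with [f c < 0] bound the coefficient [t] from below. The least such [t >= 0]
   also meets the upper bounds given by [0 < f b], by the inequalities kept or combined above. *)
have [t [t0 ts tE]] := finite_sup_ge0 [seq c <- s | f c < 0]
  (fun c => pairing x c / f c).
suff /sP [w w0 xE] : {in s, forall b, 0 <= pairing (x + (- t) *: a ord0) b}.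
  exists (fun i => if unlift ord0 i is Some j then w j else t).
    by move=> i; case: unliftP.
  rewrite big_ord_recl unlift_none; under eq_bigr do rewrite liftK.
  by rewrite -xE scaleNr addrCA subrr addr0.
move=> b bs; rewrite pairingDl pairingZl -/(f b).
have [fb|fb|fb] := ltgtP (f b) 0; last 1 first.
- by rewrite fb mulr0 addr0 xs// mem_cat mem_filter fb lexx bs.
- have := ts b; rewrite mem_filter fb => /(_ bs).
  by rewrite ler_ndivrMr// => ?; lra.
have xb : 0 <= pairing x b by rewrite xs// mem_cat mem_filter ltW// bs.
case: tE => [->|[c]]; first by lra.
rewrite mem_filter => /andP[fc cs] ->.
have : 0 <= pairing x (f b *: c - f c *: b).
  apply: xs; rewrite mem_cat; apply/orP; right; apply/allpairsP.
  by exists (b, c); rewrite !mem_filter fb fc.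
rewrite pairing_comb => h.
have -> : pairing x b + - (pairing x c / f c) * f b =
   - (f b * pairing x c - f c * pairing x b) / f c by field; lra.
by rewrite mulr_le0 ?oppr_le0 ?invr_le0// ltW.
Qed.

Lemma cone_polyhedral (R : realFieldType) n (I : finType) (a : I -> 'rV[R]_n) :
  exists s : seq 'cV[R]_n,
    forall x, cone a x <-> {in s, forall b, 0 <= pairing x b}.
Proof.
have [s sP] := cone_ord_polyhedral (fun i : 'I_#|I| => a (enum_val i)).
exists s => x; rewrite -sP; split=> -[w w0 ->].
  exists (fun i => w (enum_val i)) => //.
  by rewrite (reindex (@enum_val I predT))//; exact: onW_bij (enum_val_bij _).
exists (fun i => w (enum_rank i)) => //.
rewrite [RHS](reindex (@enum_val I predT)).
  by apply: eq_bigr => i _; rewrite enum_valK.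
exact: onW_bij (enum_val_bij _).
Qed.

(** One of the finitely many inequalities describing the cone fails at [x], while every generator,
    being in the cone, satisfies it. *)
Lemma farkas (R : realFieldType) n (I : finType) (a : I -> 'rV[R]_n) x :
  ~ cone a x -> exists2 b, forall i, 0 <= pairing (a i) b & pairing x b < 0.
Proof.
have [s sP] := cone_polyhedral a; move=> xa.
have [b bs xb] : exists2 b, b \in s & pairing x b < 0.
  apply: contra_notP xa => xa; apply/sP => b bs; rewrite leNgt.
  by apply/negP => xb; apply: xa; exists b.
exists b => // i; suff /sP/(_ b bs) : cone a (a i) by [].
exists (fun j => (j == i)%:R); first by move=> j; exact: ler0n.
rewrite (bigD1 i)//= eqxx scale1r big1 ?addr0// => j /negbTE->.
by rewrite scale0r.
Qed.

Lemma sum_option (V : nmodType) (I : finType) (F : option I -> V) :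
  \sum_o F o = F None + \sum_i F (Some i).
Proof.
rewrite (bigD1 None)//=; congr (_ + _).
rewrite (reindex_omap Some id) => [|[]//].
by apply: eq_bigl => i; rewrite eqxx.
Qed.

(** * Affine functions, homogenization and the affine Farkas lemma *)

Section affine.
Context {R : realType}.
Local Notation affine_fun := (affine_fun R).

Definition aff0 {d} : affine_fun d := (0, 0).
Definition affN {d} (h : affine_fun d) : affine_fun d := (- h.1, - h.2).

Lemma aff_eval0 d (x : 'cV[R]_d) : aff_eval aff0 x = 0.
Proof. by rewrite /aff_eval /= mul0mx mxE addr0. Qed.

Lemma aff_evalN d (h : affine_fun d) x : aff_eval (affN h) x = - aff_eval h x.
Proof. by rewrite /aff_eval /= mulNmx mxE opprD. Qed.

Lemma aff_eval_sum d (I : finType) (A : pred I) (h : affine_fun d) (w : I -> R)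
    p :
  \sum_(i | A i) w i = 1 ->
  aff_eval h (\sum_(i | A i) w i *: p i) =
    \sum_(i | A i) w i * aff_eval h (p i).
Proof.
move=> w1; rewrite /aff_eval mulmx_sumr summxE.
under [RHS]eq_bigr do rewrite mulrDr.
rewrite big_split /= -mulr_suml w1 mul1r; congr (_ + _).
by apply: eq_bigr => i _; rewrite -scalemxAr mxE.
Qed.

Lemma aff_eval_conv d (h : affine_fun d) s t x y : s + t = 1 ->
  aff_eval h (s *: x + t *: y) = s * aff_eval h x + t * aff_eval h y.
Proof.
move=> st; rewrite /aff_eval mulmxDr -!scalemxAr !mxE.
by rewrite -[X in _ + X = _]mul1r -st; ring.
Qed.

(** The linear form that agrees with [h] at height 1; it turns affine functions into generators of a
    cone, to which [farkas] applies. *)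
Definition homog {d} (h : affine_fun d) : 'rV[R]_(d + 1) := row_mx h.1 h.2%:M.

Lemma pairing_homog d (h : affine_fun d) z t :
  pairing (homog h) (col_mx z t%:M) = (h.1 *m z) 0 0 + h.2 * t.
Proof.
by rewrite /pairing mul_row_col !mxE big_ord1 !mxE eqxx !mulr1n.
Qed.

Lemma pairing_homog1 d (h : affine_fun d) x :
  pairing (homog h) (col_mx x 1%:M) = aff_eval h x.
Proof. by rewrite pairing_homog mulr1. Qed.

Lemma pairing_lift d (x : 'cV[R]_d) (b : 'cV[R]_(d + 1)) :
  pairing (row_mx x^T 1%:M) b = aff_eval ((usubmx b)^T, dsubmx b 0 0) x.
Proof.
rewrite /pairing -{1}[b]vsubmxK mul_row_col mul1mx mxE /aff_eval /=.
by rewrite -[usubmx b in LHS]trmxK -trmx_mul mxE.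
Qed.

(** The last coordinate says that the weights sum to 1. For nonnegative weights, cone membership of
    lifted points is thus membership in a convex hull. *)
Lemma lift_comb d (I : finType) (A : pred I) (w : I -> R) (p : I -> 'cV[R]_d)
    (x : 'cV[R]_d) :
  row_mx x^T (1%:M : 'M[R]_1) = \sum_(i | A i) w i *: row_mx (p i)^T 1%:M <->
  \sum_(i | A i) w i = 1 /\ x = \sum_(i | A i) w i *: p i.
Proof.
split=> [wE|[w1 ->]].
  split.
    move/(congr1 rsubmx): wE; rewrite row_mxKr linear_sum /=.
    under eq_bigr do rewrite linearZ /= row_mxKr.
    by rewrite -scaler_suml => /matrixP/(_ 0 0); rewrite !mxE mulr1 => <-.
  move/(congr1 lsubmx): wE; rewrite row_mxKl linear_sum /=.
  move=> /(congr1 trmx); rewrite trmxK => ->; rewrite linear_sum /=.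
  by apply: eq_bigr => i _; rewrite linearZ /= row_mxKl linearZ /= trmxK.
rewrite -[RHS]hsubmxK !linear_sum /=; congr row_mx.
  by apply: eq_bigr => i _; rewrite linearZ [RHS]linearZ /= row_mxKl.
under eq_bigr do rewrite linearZ /= row_mxKr.
by rewrite -scaler_suml w1 scale1r.
Qed.

Definition hpoly {d} {I : finType} (a : I -> affine_fun d) : set 'cV[R]_d :=
  [set x | forall i, 0 <= aff_eval (a i) x].

(** Farkas' lemma for the homogenized functions, with the constant 1 as an extra generator whose
    weight is [c]. A separating vector [(z, t)] would give a point of the polyhedron where [h] is
    negative. *)
Lemma affine_farkas d (I : finType) (a : I -> affine_fun d) h :
  hpoly a !=set0 -> valid_on (hpoly a) h ->
  exists c w, [/\ 0 <= c, forall i, 0 <= w i &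
    forall x, aff_eval h x = c + \sum_i w i * aff_eval (a i) x].
Proof.
move=> [x0 ax0] vh.
pose a' (o : option I) := homog (if o is Some i then a i else (0, 1)).
have [[w w0 hE]|/farkas [b ab hb]] := pselect (cone a' (homog h)).
  exists (w None), (w \o Some); split=> //= x.
  rewrite -pairing_homog1 hE pairing_sum sum_option pairing_homog1.
  rewrite {1}/aff_eval mul0mx mxE add0r mulr1; congr (_ + _).
  by apply: eq_bigr => i _; rewrite pairing_homog1.
exfalso; have [z [t bE]] : exists z t, b = col_mx z t%:M.
  by exists (usubmx b), (dsubmx b 0 0); rewrite -mx11_scalar vsubmxK.
have t0 : 0 <= t.
  by have := ab None; rewrite bE pairing_homog mul0mx mxE add0r mul1r.
have {}ab i : 0 <= ((a i).1 *m z) 0 0 + (a i).2 * t.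
  by have := ab (Some i); rewrite bE pairing_homog.
move: hb; rewrite bE pairing_homog => hb.
have mulE (k : affine_fun d) s (x y : 'cV[R]_d) :
    aff_eval k (x + s *: y) = aff_eval k x + s * (k.1 *m y) 0 0.
  by rewrite /aff_eval mulmxDr -scalemxAr !mxE addrAC.
(* For [t > 0] the point is [z / t]; for [t = 0], [z] is a recession direction along which [h]
   decreases. *)
have [tp|t_le0] := ltP 0 t.
  have Q : hpoly a (0 + t^-1 *: z).
    move=> i; rewrite mulE /aff_eval mulmx0 mxE add0r.
    rewrite -(pmulr_rge0 _ tp) mulrDr mulrA divff ?gt_eqF// mul1r.
    by have := ab i; rewrite addrC (mulrC t).
  have := vh _ Q; rewrite mulE /aff_eval mulmx0 mxE add0r.
  rewrite -(pmulr_rge0 _ tp) mulrDr mulrA divff ?gt_eqF// mul1r.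
  by rewrite addrC mulrC leNgt hb.
have {t_le0 t0} te : t = 0 by apply/le_anti/andP.
move: hb; rewrite te mulr0 addr0 => hb.
set u := (h.1 *m z) 0 0 in hb.
(* The step from [x0] is long enough for [h] to reach -1. *)
have Q : hpoly a (x0 + ((1 + aff_eval h x0) / - u) *: z).
  move=> i; rewrite mulE addr_ge0// mulr_ge0//.
    by apply: divr_ge0; [exact: addr_ge0 (vh _ _) | rewrite oppr_ge0 ltW].
  by have := ab i; rewrite te mulr0 addr0.
have := vh _ Q; rewrite mulE -/u.
have -> : (1 + aff_eval h x0) / - u * u = - (1 + aff_eval h x0).
  by field; rewrite lt_eqF.
lra.
Qed.

(** The cone over the points lifted to height 1 is polyhedral, and its slice at height 1 is their
    convex hull. *)
Lemma polytope_hpoly d (P : set 'cV[R]_d) : polytope P ->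
  exists (n : nat) (a : 'I_n -> affine_fun d), P = hpoly a.
Proof.
move=> [k [p ->]].
have [s sP] := cone_polyhedral (fun i => row_mx (p i)^T 1%:M).
exists (size s), (fun i => ((usubmx s`_i)^T, dsubmx s`_i 0 0)).
have hullE x : convex_hull p x <->
    cone (fun i => row_mx (p i)^T 1%:M) (row_mx x^T (1%:M : 'M[R]_1)).
  split=> [[w [w0 w1 xE]]|[w w0 /lift_comb[w1 xE]]]; exists w => //.
  by apply/lift_comb.
apply/seteqP; split=> x.
  move=> /hullE/sP xs i; rewrite -pairing_lift; apply: xs; exact: mem_nth.
move=> xs; apply/hullE/sP => b /(nthP 0)[i si <-].
by have := xs (Ordinal si); rewrite -pairing_lift.
Qed.

End affine.

(** * Facets of a polyhedron *)

Lemma minset_Prop (I : finType) (Pr : {set I} -> Prop) (J0 : {set I}) :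
  Pr J0 -> exists J : {set I},
    [/\ J \subset J0, Pr J & forall i, i \in J -> ~ Pr (J :\ i)%SET].
Proof.
move=> PrJ0.
have [|J /minsetP[/asboolP PJ Jmin] JJ0] :=
  @minset_exists I (fun J => `[< Pr J >]) J0; first exact/asboolP.
exists J; split=> // i iJ PJi.
have /(_ _)/esym := Jmin (J :\ i)%SET _ (subD1set _ _).
by move=> /(_ (introT (asboolP _) PJi))/setP/(_ i); rewrite !inE iJ eqxx.
Qed.

(** Complementary slackness: where a function expanded by Farkas' lemma vanishes, so does each term
    of the expansion. *)
Lemma psumr_mul_eq0 (R : numDomainType) (I : finType) (J : {set I})
    (c : R) (w g : I -> R) :
  0 <= c -> (forall i, 0 <= w i) -> (forall i, i \in J -> 0 <= g i) ->
  c + \sum_(i in J) w i * g i = 0 ->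
  c = 0 /\ forall i, i \in J -> w i * g i = 0.
Proof.
move=> c0 w0 g0 /eqP.
have wg0 i : i \in J -> 0 <= w i * g i by move=> /g0; exact: mulr_ge0.
rewrite paddr_eq0 ?sumr_ge0// => /andP[/eqP-> /eqP s0]; split=> // i iJ.
exact: (psumr_eq0P wg0 s0).
Qed.

Section facets.
Context {R : realType}.
Local Notation affine_fun := (affine_fun R).

(* The points satisfying the implicit equalities of the system [a >= 0]. *)
Definition flat {d} {I : finType} (a : I -> affine_fun d) : set 'cV[R]_d :=
  [set x | forall i, (forall y, hpoly a y -> aff_eval (a i) y = 0) ->
     aff_eval (a i) x = 0].

Lemma hpoly_flat d (I : finType) (a : I -> affine_fun d) :
  hpoly a `<=` flat a.
Proof. by move=> x ax i; exact. Qed.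

(** The inequalities in [J], with the implicit equalities written as pairs of inequalities, have the
    same solutions as [a]. The terms of the equalities vanish on [flat a], which leaves a sum over
    [J]. *)
Lemma farkas_flat d (I : finType) (a : I -> affine_fun d) (J : {set I})
    (h : affine_fun d) :
  hpoly a !=set0 ->
  (forall x, flat a x -> (forall j, j \in J -> 0 <= aff_eval (a j) x) ->
     hpoly a x) ->
  valid_on (hpoly a) h ->
  exists c w, [/\ 0 <= c, forall i, 0 <= w i & forall x, flat a x ->
    aff_eval h x = c + \sum_(i in J) w i * aff_eval (a i) x].
Proof.
move=> a0 aJ vh.
pose E i := `[< forall y, hpoly a y -> aff_eval (a i) y = 0 >].
(* The summand [inr] holds the reversed equalities; the remaining slots are filled with the trivial
   inequality [0 >= 0]. *)
pose a' (o : I + I) := match o with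
  | inl i => if E i then a i else if i \in J then a i else aff0
  | inr i => if E i then affN (a i) else aff0 end.
have a'E : hpoly a' = hpoly a.
  apply/seteqP; split=> x ax.
    apply: aJ => [i Ei|j jJ].
      have := ax (inl i); have := ax (inr i); rewrite /= /E asboolT// aff_evalN.
      by rewrite oppr_ge0 => ? ?; apply/le_anti/andP.
    by have := ax (inl j); rewrite /= jJ; case: ifP.
  case=> i /=; case: ifPn => [/asboolP Ei|_].
  - exact: ax.
  - by case: ifP => _; [exact: ax | rewrite aff_eval0].
  - by rewrite aff_evalN Ei// oppr0.
  - by rewrite aff_eval0.
have [||c [w [c0 w0 hE]]] := @affine_farkas R d _ a' h; rewrite ?a'E//.
exists c, (w \o inl); split=> [//|i|x fx]; first exact: w0.
rewrite hE big_sumType /= [X in _ + (_ + X)]big1 ?addr0 => [|i _]; last first.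
  case: ifPn => [/asboolP Ei|_]; last by rewrite aff_eval0 mulr0.
  by rewrite aff_evalN fx// oppr0 mulr0.
congr (_ + _); rewrite [RHS]big_mkcond /=; apply: eq_bigr => i _.
case: ifPn => [/asboolP Ei|_]; first by rewrite fx// mulr0 if_same.
by case: ifP => // _; rewrite aff_eval0 mulr0.
Qed.

(** Take the barycentre of one witness for each index; [x0] is added so that the family is never
    empty. *)
Lemma interior_point d (I : finType) (a : I -> affine_fun d) (J : {set I}) :
  hpoly a !=set0 ->
  (forall i, i \in J -> exists2 y, hpoly a y & aff_eval (a i) y <> 0) ->
  exists2 x, hpoly a x & forall i, i \in J -> 0 < aff_eval (a i) x.
Proof.
move=> [x0 ax0] aJ.
have /choice[y yP] (i : I) : exists y, hpoly a y /\
    (i \in J -> 0 < aff_eval (a i) y).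
  have [/aJ[y ay aiy]|iJ] := boolP (i \in J); last by exists x0.
  by exists y; split=> // _; rewrite lt_neqAle ay eq_sym andbT; exact/eqP.
pose z (o : option I) := if o is Some i then y i else x0.
have az o : hpoly a (z o) by case: o => //= i; case: (yP i).
pose N : R := #|{: option I}|%:R.
have N0 : 0 < N by rewrite ltr0n; apply/card_gt0P; exists None.
have wP : \sum_(o : option I) N^-1 = 1.
  by rewrite sumr_const -mulr_natr mulVf// gt_eqF.
exists (\sum_o N^-1 *: z o) => [i|i iJ]; rewrite aff_eval_sum//.
  by apply: sumr_ge0 => o _; rewrite mulr_ge0 ?invr_ge0 ?(ltW N0)//; exact: az.
rewrite (bigD1 (Some i))//= ltr_pwDl//.
  by rewrite mulr_gt0 ?invr_gt0//; case: (yP i) => _; exact.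
by apply: sumr_ge0 => o _; rewrite mulr_ge0 ?invr_ge0 ?(ltW N0)//; exact: az.
Qed.

(** That every facet arises from some [j] in [J] is not demanded here; [facet_generator] derives
    it. *)
Definition irredundant {d} {I : finType} (a : I -> affine_fun d)
    (J : {set I}) : Prop :=
  [/\ forall j, j \in J -> facet (hpoly a) (tight_set (hpoly a) (a j)),
      {in J &, injective (fun j => tight_set (hpoly a) (a j))} &
      forall x, flat a x -> (forall j, j \in J -> 0 <= aff_eval (a j) x) ->
        hpoly a x].

(* A minimal subsystem works: the segment from an interior point to a point
   violating only the inequality [j] meets the facet of [j] and no other one. *)
Lemma irredundant_exists d (I : finType) (a : I -> affine_fun d) :
  hpoly a !=set0 -> exists J : {set I}, irredundant a J.
Proof.
move=> a0.
pose E i := `[< forall y, hpoly a y -> aff_eval (a i) y = 0 >].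
have [|J [JE aJ Jmin]] := @minset_Prop I (fun J => forall x, flat a x ->
  (forall j, j \in J -> 0 <= aff_eval (a j) x) -> hpoly a x)
  [set i | ~~ E i]%SET.
  move=> x fx xJ i; have [/asboolP Ei|Ei] := boolP (E i); first by rewrite fx.
  by apply: xJ; rewrite inE.
have {}JE i : i \in J -> exists2 y, hpoly a y & aff_eval (a i) y <> 0.
  move=> /(fintype.subsetP JE); rewrite inE => /asboolPn.
  by move=> /existsNP[y /not_implyP[]]; exists y.
have [x0 ax0 x0J] := interior_point a0 JE.
have /choice[y yP] (j : I) : exists y, j \in J -> [/\ hpoly a y,
    aff_eval (a j) y = 0 &
    forall i, i \in J -> i != j -> 0 < aff_eval (a i) y].
  have [jJ|_] := boolP (j \in J); last by exists 0.
  have /existsNP[z /not_implyP[fz /not_implyP[zJ az]]] := Jmin _ jJ.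
  have {}zJ i : i \in J -> i != j -> 0 <= aff_eval (a i) z.
    by move=> iJ ij; apply: zJ; rewrite !inE ij.
  have ajz : aff_eval (a j) z < 0.
    rewrite ltNge; apply/negP => ajz; apply: az; apply: aJ => // i iJ.
    by have [->//|ij] := eqVneq i j; exact: zJ.
  have ajx := x0J _ jJ.
  set s := aff_eval (a j) x0 in ajx; set t := aff_eval (a j) z in ajz.
  have st : 0 < s - t by lra.
  (* The weights are those for which [a j], with value [s > 0] at [x0] and [t < 0] at [z],
     vanishes. *)
  exists ((- t / (s - t)) *: x0 + (s / (s - t)) *: z) => _.
  have w1 : - t / (s - t) + s / (s - t) = 1 by field; rewrite gt_eqF.
  have w0 : 0 < - t / (s - t) by rewrite divr_gt0// oppr_gt0.
  have w0' : 0 < s / (s - t) by rewrite divr_gt0.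
  set y := _ + _.
  have yj : aff_eval (a j) y = 0.
    by rewrite aff_eval_conv// -/s -/t; field; rewrite gt_eqF.
  have yi i : i \in J -> i != j -> 0 < aff_eval (a i) y.
    move=> iJ ij; rewrite aff_eval_conv//; apply: ltr_pwDl.
      by rewrite mulr_gt0// x0J.
    by rewrite mulr_ge0 ?(ltW w0')// zJ.
  split=> //; apply: aJ => [i Ei|i iJ].
    by rewrite aff_eval_conv// fz// Ei// !mulr0 addr0.
  by have [->|ij] := eqVneq i j; [rewrite yj | exact/ltW/yi].
exists J; split=> // [j jJ|i j iJ jJ ijE]; last first.
  apply/eqP; apply: contraT => ij; have [ay yj yi] := yP _ jJ.
  have : tight_set (hpoly a) (a i) (y j) by rewrite ijE.
  by move=> [_ /eqP]; rewrite gt_eqF// yi.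
have [ay yj yi] := yP _ jJ; split.
- by exists (a j) => // x; exact.
- by exists (y j).
- by move=> aE; move: ax0; rewrite -{1}aE => -[_ /eqP]; rewrite gt_eqF ?x0J.
(* Maximality: [h] vanishes at [y j], where all other inequalities of [J] are strict, so only the
   term of [j] survives in its Farkas expansion. *)
move=> _ [h vh ->] hQ jh.
have [c [w [c0 w0 hE]]] := farkas_flat a0 aJ vh.
have : aff_eval h (y j) = 0 by case: (jh (y j)).
rewrite hE; last exact: hpoly_flat.
move=> /(psumr_mul_eq0 c0 w0 (fun i _ => ay i))[c_eq0 wy0].
have {}hE x : hpoly a x -> aff_eval h x = w j * aff_eval (a j) x.
  move=> ax; rewrite hE; last exact: hpoly_flat.
  rewrite c_eq0 add0r (bigD1 j)//= big1 ?addr0// => i /andP[iJ ij].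
  have /eqP := wy0 _ iJ; rewrite mulf_eq0 (gt_eqF (yi _ iJ ij)) orbF => /eqP->.
  by rewrite mul0r.
have wj : w j != 0.
  apply/eqP => wj; apply: hQ; apply/seteqP; split=> [x []//|x ax].
  by split=> //; rewrite hE// wj mul0r.
apply/seteqP; split=> x [ax hx]; split=> //.
  by move: hx; rewrite hE// => /eqP; rewrite mulf_eq0 (negbTE wj) => /eqP.
by rewrite hE// hx mulr0.
Qed.

(** In the Farkas expansion of [h] the constant vanishes, as the facet is nonempty. Each [a i] of
    nonzero weight is tight on the facet, hence defines it by maximality, and irredundancy leaves a
    single such [i]. *)
Lemma facet_generator d (I : finType) (a : I -> affine_fun d) (J : {set I})
    (h : affine_fun d) :
  hpoly a !=set0 ->
  irredundant a J ->
  valid_on (hpoly a) h -> facet (hpoly a) (tight_set (hpoly a) h) ->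
  exists j w, [/\ j \in J, 0 < w,
    tight_set (hpoly a) (a j) = tight_set (hpoly a) h &
    forall x, flat a x -> aff_eval h x = w * aff_eval (a j) x].
Proof.
move=> a0 [aF aI aJ] vh [_ [y0 hy0] hQ hmax].
have [c [w [c0 w0 hE]]] := farkas_flat a0 aJ vh.
have h0 x : tight_set (hpoly a) h x ->
    c = 0 /\ forall i, i \in J -> w i * aff_eval (a i) x = 0.
  move=> [ax]; rewrite hE; last exact: hpoly_flat.
  by move=> /(psumr_mul_eq0 c0 w0 (fun i _ => ax i)).
have [c_eq0 _] := h0 _ hy0.
have wE i : i \in J -> w i != 0 ->
    tight_set (hpoly a) (a i) = tight_set (hpoly a) h.
  move=> iJ wi; have [faF _ anQ _] := aF _ iJ; apply: hmax => // x hx.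
  split; first by case: hx.
  have [_ /(_ _ iJ)/eqP] := h0 _ hx.
  by rewrite mulf_eq0 (negbTE wi) => /eqP.
have [j jJ wj] : exists2 j, j \in J & w j != 0.
  apply: contra_notP hQ => wJ; apply/seteqP; split=> [x []//|x ax].
  split=> //; rewrite hE; last exact: hpoly_flat.
  rewrite c_eq0 add0r big1// => i iJ.
  have [->|wi] := eqVneq (w i) 0; first by rewrite mul0r.
  by exfalso; apply: wJ; exists i.
exists j, (w j); split=> // [||x fx].
- by rewrite lt_neqAle eq_sym wj w0.
- exact: wE.
rewrite hE// c_eq0 add0r (bigD1 j)//= big1 ?addr0// => i /andP[iJ ij].
have [->|wi] := eqVneq (w i) 0; first by rewrite mul0r.
by move/eqP: ij; case; apply: aI => //; rewrite !wE.
Qed.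

Lemma card_facets d (I : finType) (a : I -> affine_fun d) (J : {set I}) :
  hpoly a !=set0 ->
  irredundant a J ->
  ([set F | facet (hpoly a) F] #= `I_#|J|)%card.
Proof.
move=> a0 irrJ; have [aF aI _] := irrJ.
pose f (k : 'I_#|J|) := tight_set (hpoly a) (a (enum_val k)).
have -> : [set F | facet (hpoly a) F] = f @` setT.
  apply/seteqP; split=> [F fF|_ [k _ <-]]; last exact: aF (enum_valP _).
  have [[h vh FE] _ _ _] := fF; rewrite FE in fF.
  have [j [_ [jJ _ jh _]]] := facet_generator a0 irrJ vh fF.
  by exists (enum_rank_in jJ j) => //; rewrite /f enum_rankK_in// jh.
apply: (card_eq_trans (inj_card_eq _)).
  move=> k l _ _ fkl; apply: enum_val_inj; apply: aI fkl; exact: enum_valP.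
by rewrite card_eq_sym; exact: card_II.
Qed.

Lemma polyhedronP d (Q : set 'cV[R]_d) :
  polyhedron Q <-> exists (n : nat) (a : 'I_n -> affine_fun d), Q = hpoly a.
Proof.
have rowE k (A : 'M[R]_(k, d)) x i : (A *m x) i 0 = (row i A *m x) 0 0.
  by rewrite -row_mul [RHS]mxE.
split=> [[k [A [b ->]]]|[k [a ->]]].
  exists k, (fun i => (- row i A, b i 0)); apply/seteqP; split=> x xP i;
  by have := xP i; rewrite rowE /aff_eval /= mulNmx !mxE; lra.
exists k, (\matrix_i - (a i).1), (\col_i (a i).2).
have AE x i : (\matrix_i (- (a i).1) *m x) i 0 = - ((a i).1 *m x) 0 0.
  by rewrite rowE rowK mulNmx [LHS]mxE.
have bE i : (\col_i (a i).2) i 0 = (a i).2 by rewrite mxE.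
by apply/seteqP; split=> x xP i; have := xP i; rewrite AE bE /aff_eval; lra.
Qed.

End facets.

(** * Extensions and nonnegative factorizations of the slack matrix *)

Section slack.
Context {R : realType}.
Local Notation affine_fun := (affine_fun R).

Lemma convex_hull_mem d k (p : 'I_k -> 'cV[R]_d) i : convex_hull p (p i).
Proof.
exists (fun j => (j == i)%:R); split=> [j|//|]; first exact: ler0n.
  by rewrite (bigD1 i)//= eqxx big1 ?addr0// => j /negbTE->.
rewrite (bigD1 i)//= eqxx scale1r big1 ?addr0// => j /negbTE->.
by rewrite scale0r.
Qed.

(* A generator outside of the convex hull of the others is separated from them,
   hence a vertex; so a minimal generating family consists of vertices. *)
Lemma polytope_hull_vertices d (P : set 'cV[R]_d) : polytope P ->
  exists (k : nat) (p : 'I_k -> 'cV[R]_d),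
    (forall i, vertex P (p i)) /\ P = convex_hull p.
Proof.
move=> [k [p PE]].
have [|J [_ PJ Jmin]] := @minset_Prop _ (fun J => forall x, P x ->
  exists w : 'I_k -> R, [/\ forall i, 0 <= w i, \sum_(i in J) w i = 1 &
    x = \sum_(i in J) w i *: p i]) [set: 'I_k]%SET.
  rewrite PE => _ [w [w0 w1 ->]]; exists w; split=> //.
    by rewrite -[RHS]w1; apply: eq_bigl => i; rewrite inE.
  by apply: eq_bigl => i; rewrite inE.
exists #|J|, (fun i => p (enum_val i)); split; last first.
  rewrite eqEsubset; split=> [x /PJ[w [w0 w1 xE]]|x [w [w0 w1 xE]]].
    exists (fun i => w (enum_val i)); split=> //.
      by rewrite -[RHS]w1 [RHS]big_enum_val.
    by rewrite xE big_enum_val.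
  rewrite PE; exists (fun j => \sum_(i | enum_val i == j) w i); split.
  - by move=> j; rewrite sumr_ge0.
  - by rewrite -[RHS]w1 [RHS](partition_big (fun i => enum_val i) xpredT).
  rewrite xE (partition_big (fun i => enum_val i) xpredT)//=.
  by apply: eq_bigr => j _; rewrite scaler_suml; apply: eq_bigr => i /eqP->.
move=> l; set j := enum_val l; have jJ : j \in J := enum_valP l.
pose a i := if i \in (J :\ j)%SET then row_mx (p i)^T 1%:M else 0.
have [[u u0 uE]|/farkas[b ab bj]] := pselect (cone a (row_mx (p j)^T 1%:M)).
  case: (Jmin _ jJ) => x /PJ[w [w0 w1 ->]].
  have [u1 pjE] : \sum_(i in (J :\ j)%SET) u i = 1 /\
      p j = \sum_(i in (J :\ j)%SET) u i *: p i.
    apply/lift_comb; rewrite uE [RHS]big_mkcond/=; apply: eq_bigr => i _.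
    by rewrite /a; case: ifP => // _; rewrite scaler0.
  (* Replacing [p j] by its expression in the other points makes [j] dispensable, against the
     minimality of [J]. *)
  exists (fun i => w j * u i + w i); split.
  - by move=> i; rewrite addr_ge0 ?mulr_ge0.
  - by rewrite big_split/= -mulr_sumr u1 mulr1 -[RHS]w1 [RHS](big_setD1 j).
  rewrite (big_setD1 j)//= {1}pjE scaler_sumr -big_split/=.
  by apply: eq_bigr => i _; rewrite scalerDl scalerA.
pose h0 : affine_fun d := ((usubmx b)^T, dsubmx b 0 0).
rewrite pairing_lift -/h0 in bj.
(* The separating function is shifted to vanish at [p j], and is positive at the other points of the
   family. *)
pose h : affine_fun d := (h0.1, h0.2 - aff_eval h0 (p j)).
have hE x : aff_eval h x = aff_eval h0 x - aff_eval h0 (p j).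
  by rewrite /aff_eval /= addrA.
have hj : aff_eval h (p j) = 0 by rewrite hE subrr.
have hi i : i \in (J :\ j)%SET -> 0 < aff_eval h (p i).
  move=> iJ; have := ab i; rewrite /a iJ pairing_lift -/h0 hE; lra.
have hsum w : \sum_(i in J) w i = 1 ->
    aff_eval h (\sum_(i in J) w i *: p i) =
    \sum_(i in (J :\ j)%SET) w i * aff_eval h (p i).
  by move=> w1; rewrite aff_eval_sum// (big_setD1 j)//= hj mulr0 add0r.
exists h.
  move=> x /PJ[w [w0 w1 ->]]; rewrite hsum// sumr_ge0// => i iJ.
  by rewrite mulr_ge0// ltW// hi.
rewrite eqEsubset; split=> [_ ->|x [Px hx0]].
  by split=> //; rewrite PE; exact: convex_hull_mem.
have [w [w0 w1 xE]] := PJ _ Px.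
move: hx0; rewrite xE hsum// => /psumr_eq0P hw.
have {}hw i : i \in (J :\ j)%SET -> w i = 0.
  move=> iJ; have /eqP : w i * aff_eval h (p i) = 0.
    by apply: hw => // i' i'J; rewrite mulr_ge0// ltW// hi.
  by rewrite mulf_eq0 (gt_eqF (hi _ iJ)) orbF => /eqP.
have w1' : w j = 1 by rewrite -w1 (big_setD1 j)//= big1 ?addr0.
rewrite (big_setD1 j)//= big1 ?addr0 => [|i /hw->]; last by rewrite scale0r.
by rewrite w1' scale1r.
Qed.

Lemma polytope_bounded d (P : set 'cV[R]_d) : polytope P ->
  exists M, forall x i, P x -> `|x i 0| <= M i.
Proof.
move=> [k [p ->]]; exists (fun i => \sum_l `|p l i 0|) => _ i [w [w0 w1 ->]].
rewrite summxE (le_trans (ler_norm_sum _ _ _))//; apply: ler_sum => l _.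
rewrite mxE normrM ger0_norm// ler_piMl//.
by rewrite -w1 (bigD1 l)//= lerDl sumr_ge0.
Qed.

(** In other words, the nonnegative rank of [S] is at most [k]. *)
Definition nonneg_factorization {m n} (S : 'M[R]_(m, n)) (k : nat) : Prop :=
  exists (T : 'M[R]_(m, k)) (U : 'M[R]_(k, n)),
    [/\ forall i l, 0 <= T i l, forall l j, 0 <= U l j & S = T *m U].

Lemma aff_linear d e (pi : {linear 'cV[R]_e -> 'cV[R]_d}) (h : affine_fun d) :
  exists h' : affine_fun e, forall x, aff_eval h' x = aff_eval h (pi x).
Proof.
exists (\row_j (h.1 *m pi (delta_mx j 0)) 0 0, h.2) => x.
have {2}-> : x = \sum_j x j 0 *: delta_mx j 0.
  apply/colP => i; rewrite summxE (bigD1 i)//= !mxE !eqxx mulr1 big1 ?addr0//.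
  by move=> j ji; rewrite !mxE [i == j]eq_sym (negbTE ji) mulr0.
rewrite /aff_eval /= linear_sum mulmx_sumr summxE mxE; congr (_ + _).
apply: eq_bigr => j _; rewrite linearZ /= -scalemxAr [in RHS]mxE mulrC.
by rewrite [(\row__ _) _ _]mxE.
Qed.

(* Pulling a facet inequality of [P] back to the extension, Farkas' lemma writes
   it in terms of the facets there; the constant vanishes since facets are
   nonempty. *)
Lemma extension_factorization d (P : set 'cV[R]_d) m n (S : 'M[R]_(m, n)) r :
  P !=set0 -> slack_matrix P S -> has_extension_of_size P r ->
  nonneg_factorization S r.
Proof.
move=> P0 [h [v [hF _ _ vP ->]]] [e [Q [pi [[/polyhedronP[k [a ->]] QP] Qr]]]].
have a0 : hpoly a !=set0.
  by case: P0 => x; rewrite -QP => -[y ay _]; exists y.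
have [J irrJ] := irredundant_exists a0; have [_ _ aJ] := irrJ.
have -> : r = #|J|.
  apply/card_eq_II; apply: card_eq_trans (card_facets a0 irrJ).
  by rewrite card_eq_sym.
have PQ x : P x -> exists2 q, hpoly a q & pi q = x by rewrite -QP.
have /choice[T TP] i : exists w : 'I_k -> R, (forall l, 0 <= w l) /\
    forall q, hpoly a q ->
      aff_eval (h i) (pi q) = \sum_(l in J) w l * aff_eval (a l) q.
  have [vh [_ [x [Px hx]] _ _]] := hF i; have [h' hE] := aff_linear pi (h i).
  have vh' : valid_on (hpoly a) h'.
    by move=> q aq; rewrite hE; apply: vh; rewrite -QP; exists q.
  have [c [w [c0 w0 cwE]]] := farkas_flat a0 aJ vh'; exists w; split=> // q aq.
  suff c_eq0 : c = 0.
    by rewrite -hE cwE ?c_eq0 ?add0r//; exact: hpoly_flat.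
  have [q' aq' q'x] := PQ _ Px.
  have := cwE _ (hpoly_flat aq'); rewrite hE q'x hx => /esym.
  by move=> /(psumr_mul_eq0 c0 w0 (fun i _ => aq' i))[].
have /choice[q qP] j : exists q, hpoly a q /\ pi q = v j.
  have [|q aq qv] := PQ (v j); last by exists q.
  have [h' _ hE] : vertex P (v j) by apply/vP; exists j.
  suff : tight_set P h' (v j) by case.
  by rewrite -hE.
(* The left factor holds Farkas weights, the right one the slacks, in the extension, of chosen
   preimages of the vertices. *)
exists (\matrix_(i, l) T i (enum_val l)),
  (\matrix_(l, j) aff_eval (a (enum_val l)) (q j)).
split.
- by move=> i l; rewrite mxE; case: (TP i).
- by move=> l j; rewrite mxE; case: (qP j).
apply/matrixP => i j; rewrite !mxE; have [aq <-] := qP j.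
rewrite (TP i).2// big_enum_val; apply: eq_bigr => l _.
by rewrite !mxE.
Qed.

(** Within [flat b], each inequality of an irredundant subsystem is a positive multiple of the [h i]
    defining the same facet. *)
Lemma facet_functions_complete d (I : finType) (b : I -> affine_fun d) m
    (h : 'I_m -> affine_fun d) :
  hpoly b !=set0 ->
  (forall i, valid_on (hpoly b) (h i) /\
     facet (hpoly b) (tight_set (hpoly b) (h i))) ->
  (forall F, facet (hpoly b) F ->
     exists! i, F = tight_set (hpoly b) (h i)) ->
  forall x, flat b x -> (forall i, 0 <= aff_eval (h i) x) -> hpoly b x.
Proof.
move=> b0 hF Fh x fx hx; have [J irrJ] := irredundant_exists b0.
have [bF bI bJ] := irrJ; apply: bJ => // j jJ.
have [i [jE _]] := Fh _ (bF _ jJ); have [vh fh] := hF i.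
have [j' [w [j'J w0 j'E hE]]] := facet_generator b0 irrJ vh fh.
have jj' : j = j' by apply: bI => //; rewrite jE j'E.
by move: (hx i); rewrite hE// pmulr_rge0// jj'.
Qed.

(* The extension is [Q = {(x, y) | h x = T y, y >= 0}], with [x] restricted to
   the affine hull of [P]. *)
Lemma factorization_extension d (P : set 'cV[R]_d) m n (S : 'M[R]_(m, n)) k :
  polytope P -> P !=set0 -> slack_matrix P S -> nonneg_factorization S k ->
  exists2 r, has_extension_of_size P r & (r <= k)%N.
Proof.
move=> hP P0 [h [v [hF Fh _ vP SE]]] [T [U [T0 U0 STU]]].
have [N [b PE]] := polytope_hpoly hP.
have [K [p [pv hullE]]] := polytope_hull_vertices hP.
pose E i := `[< forall y, hpoly b y -> aff_eval (b i) y = 0 >].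
(* The equations of [Q]: the implicit equalities of [P] in [x], then [h i x - (T y)_i = 0]. *)
pose eqf (o : 'I_N + 'I_m) : affine_fun (d + k) := match o with
  | inl i => if E i then (row_mx (b i).1 0, (b i).2) else aff0
  | inr i => (row_mx (h i).1 (- row i T), (h i).2) end.
pose a (o : ('I_N + 'I_m) + ('I_N + 'I_m) + 'I_k) : affine_fun (d + k) :=
  match o with
  | inl (inl o) => eqf o | inl (inr o) => affN (eqf o)
  | inr l => (row_mx 0 (delta_mx 0 l), 0) end.
have aE q : hpoly a q <-> (forall o, aff_eval (eqf o) q = 0) /\
    forall l, 0 <= dsubmx q l 0.
  have lE l : aff_eval (a (inr l)) q = dsubmx q l 0.
    rewrite /aff_eval -{1}[q]vsubmxK /= mul_row_col mul0mx add0r addr0.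
    by rewrite -rowE mxE.
  split=> [aq|[eq0 ge0] [[u|u]|l]].
  - split=> [u|l]; last by rewrite -lE.
    apply/le_anti; rewrite (aq (inl (inl u))) andbT.
    by rewrite -oppr_ge0 -aff_evalN (aq (inl (inr u))).
  - by rewrite /= eq0.
  - by rewrite /= aff_evalN eq0 oppr0.
  - by rewrite lE.
have eqfh i x y : aff_eval (eqf (inr i)) (col_mx x y) =
    aff_eval (h i) x - (T *m y) i 0.
  rewrite /aff_eval /= mul_row_col mulNmx -row_mul mxE.
  by rewrite [X in _ + X + _]mxE [in X in _ - X + _]mxE; ring.
have eqfb i x y : aff_eval (eqf (inl i)) (col_mx x y) =
    if E i then aff_eval (b i) x else 0.
  rewrite /=; case: ifP => _; last by rewrite aff_eval0.
  by rewrite /aff_eval /= mul_row_col mul0mx addr0.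
pose pi : {linear 'cV[R]_(d + k) -> 'cV[R]_d} := usubmx.
have QP : pi @` hpoly a = P.
  rewrite eqEsubset; split=> [_ [q /aE[eq0 ge0] <-]|x].
    have eqx o : aff_eval (eqf o) (col_mx (usubmx q) (dsubmx q)) = 0.
      by rewrite vsubmxK.
    rewrite PE; rewrite PE in P0 hF Fh.
    apply: (facet_functions_complete P0 hF Fh).
      by move=> i Ei; have := eqx (inl i); rewrite eqfb /E asboolT.
    move=> i; have /eqP := eqx (inr i); rewrite eqfh subr_eq0 => /eqP->.
    by rewrite mxE sumr_ge0// => l _; rewrite mulr_ge0.
  rewrite {1}hullE => -[w [w0 w1 ->]].
  have /choice[q qP] l : exists q, hpoly a q /\ pi q = p l.
    have /vP[j pE] := pv l.
    (* A vertex lifts by the matching column of [U], because [S = T U]; convex combinations lift the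
       rest of [P]. *)
    exists (col_mx (p l) (col j U)); split; last exact: col_mxKu.
    apply/aE; split=> [[i|i]|l']; last by rewrite col_mxKd mxE.
      rewrite eqfb; case: ifP => // /asboolP; apply.
      by rewrite -PE hullE; exact: convex_hull_mem.
    rewrite eqfh; have -> : (T *m col j U) i 0 = S i j.
      by rewrite STU !mxE; apply: eq_bigr => l' _; rewrite mxE.
    by rewrite SE mxE pE subrr.
  exists (\sum_l w l *: q l).
    move=> o; rewrite aff_eval_sum// sumr_ge0// => l _.
    by rewrite mulr_ge0//; case: (qP l).
  rewrite linear_sum; apply: eq_bigr => l _; rewrite linearZ.
  by case: (qP l) => _ ->.
have a0 : hpoly a !=set0.
  by case: P0 => x; rewrite -{1}QP => -[q aq _]; exists q.
have [J irrJ] := irredundant_exists a0; have [aF _ _] := irrJ.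
exists #|J|.
  exists (d + k)%N, (hpoly a), pi; split; last exact: card_facets.
  split=> //; apply/polyhedronP.
  exists _, (fun i : 'I_#|{: ('I_N + 'I_m) + ('I_N + 'I_m) + 'I_k}| =>
    a (enum_val i)).
  apply/seteqP; split=> q aq o //; have := aq (enum_rank o).
  by rewrite enum_rankK.
(* The equations are tight on all of [Q], so only the [k] inequalities [y_l >= 0] can define
   facets. *)
pose f : 'I_k -> ('I_N + 'I_m) + ('I_N + 'I_m) + 'I_k := inr.
rewrite -[leqRHS]card_ord -(card_imset (f := f) predT inr_inj).
apply: subset_leq_card; apply/fintype.subsetP => o oJ.
suff [l ->] : exists l, o = inr l by exact: imset_f.
have [_ _ aQ _] := aF _ oJ.
case: o oJ aQ => [u|l]; last by exists l.
move=> _ []; apply/seteqP; split=> [q []//|q aq]; split=> //.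
have /aE[eq0 _] := aq.
by case: u => u /=; rewrite ?aff_evalN eq0 ?oppr0.
Qed.

(* If the slack matrix had rank one, all facets would meet in a vertex, and [P]
   would be a cone. *)
Lemma factorization1_slack0 d (P : set 'cV[R]_d) m n (S : 'M[R]_(m, n)) :
  polytope P -> P !=set0 -> ~ (exists x, P = [set x]) -> slack_matrix P S ->
  nonneg_factorization S 1 -> S = 0.
Proof.
move=> hP P0 nP [h [v [hF Fh _ vP SE]]] [T [U [_ _ STU]]].
have [N [b PE]] := polytope_hpoly hP.
have [K [p [pv hullE]]] := polytope_hull_vertices hP.
have Sij i j : S i j = T i 0 * U 0 j by rewrite STU mxE big_ord1.
apply/matrixP => i0 j0; rewrite [RHS]mxE; apply: contra_notP nP => /eqP.
rewrite Sij mulf_eq0 negb_or => /andP[Ti0 _].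
have [vh [_ [x [Px hx]] _ _]] := hF i0.
move: Px hx; rewrite {1}hullE => -[w [w0 w1 ->]]; rewrite aff_eval_sum// => hx.
have pP l : P (p l) by rewrite hullE; exact: convex_hull_mem.
(* A point of the facet [i0] is a convex combination of vertices, and those of nonzero weight lie on
   the facet too. *)
have [l wl] : exists l, w l != 0.
  apply/existsP; apply: contra_eqT w1; rewrite negb_exists => /forallP w_eq0.
  rewrite big1 => [|l _]; first by rewrite eq_sym oner_eq0.
  by apply/eqP; rewrite -[_ == _]negbK.
have /vP[j pE] := pv l.
have hj0 : aff_eval (h i0) (v j) = 0.
  have /eqP : w l * aff_eval (h i0) (p l) = 0.
    by apply: (psumr_eq0P _ hx) => // l' _; exact: mulr_ge0 (vh _ (pP l')).
  by rewrite mulf_eq0 (negbTE wl) pE => /eqP.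
(* Since [T i0 0] is nonzero, the zero entry forces [U 0 j = 0], and the whole column [j] of [S]
   vanishes. *)
have hj i : aff_eval (h i) (v j) = 0.
  have hS i' : aff_eval (h i') (v j) = S i' j by rewrite SE mxE.
  have /eqP := hj0; rewrite hS Sij mulf_eq0 (negbTE Ti0) /= => /eqP Uj.
  by rewrite hS Sij Uj mulr0.
have Pv : P (v j) by rewrite -pE.
exists (v j); apply/seteqP; split=> [y Py|_ ->//] /=.
apply/eqP; apply: contraT => yv.
have [c yc] : exists c, y c 0 != v j c 0.
  apply/existsP; apply: contraNT yv; rewrite negb_exists => /forallP yv.
  by apply/eqP/colP => c; apply/eqP; rewrite -[_ == _]negbK.
(* All facet functions vanish at [v j] and are nonnegative at [y], so [P] contains the ray from
   [v j] through [y]. *)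
have ray t : 0 <= t -> P ((1 - t) *: v j + t *: y).
  move=> t0; rewrite PE; rewrite PE in P0 hF Fh Pv Py.
  apply: (facet_functions_complete P0 hF Fh) => i.
    move=> Ei; rewrite aff_eval_conv ?subrK// !Ei// !mulr0 addr0//.
  rewrite aff_eval_conv ?subrK// hj mulr0 add0r mulr_ge0//.
  by case: (hF i) => vi _; exact: vi.
have [M MP] := polytope_bounded hP.
pose D := `|y c 0 - v j c 0|.
have D0 : 0 < D by rewrite normr_gt0 subr_eq0.
have M0 : 0 <= M c by rewrite (le_trans _ (MP _ c Pv)).
(* Coordinate [c] then moves by [2 M c + 1], more than two points of [P] can differ. *)
pose t := (M c + M c + 1) / D.
have t0 : 0 <= t by rewrite divr_ge0 ?(ltW D0)//; lra.
have := MP _ c (ray t t0); have := MP _ c Pv.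
have -> : ((1 - t) *: v j + t *: y) c 0 = v j c 0 + t * (y c 0 - v j c 0).
  by rewrite !mxE; ring.
have : t * D = M c + M c + 1 by rewrite /t divfK// gt_eqF.
rewrite -[t in t * D]ger0_norm// -normrM.
move: (t * _) => z zE vM vzM.
have := ler_normB (v j c 0 + z) (v j c 0); rewrite addrAC subrr add0r zE; lra.
Qed.

End slack.

(** * Protocols and nonnegative factorizations *)

Lemma leq_add_exp2 k k' h h' : (k <= 2 ^ h)%N -> (k' <= 2 ^ h')%N ->
  (k + k' <= 2 ^ (maxn h h').+1)%N.
Proof.
move=> kh k'h'; rewrite expnS mul2n -addnn leq_add//.
  by rewrite (leq_trans kh)// leq_pexp2l ?leq_maxl.
by rewrite (leq_trans k'h')// leq_pexp2l ?leq_maxr.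
Qed.

Section protocols.
Context {R : realType}.

Lemma expected_value_NodeX (X Y : Type) (p0 p1 : X -> R) (l r : protocol R X Y)
    x y :
  expected_value (NodeX p0 p1 l r) x y =
  p0 x * expected_value l x y + p1 x * expected_value r x y.
Proof.
rewrite /expected_value /= big_cons mulr0 add0r big_cat !big_map !mulr_sumr /=.
by congr (_ + _); apply: eq_bigr => o _; rewrite mulrA.
Qed.

Lemma expected_value_NodeY (X Y : Type) (q0 q1 : Y -> R) (l r : protocol R X Y)
    x y :
  expected_value (NodeY q0 q1 l r) x y =
  q0 y * expected_value l x y + q1 y * expected_value r x y.
Proof.
rewrite /expected_value /= big_cons mulr0 add0r big_cat !big_map !mulr_sumr /=.
by congr (_ + _); apply: eq_bigr => o _; rewrite mulrA.
Qed.

Lemma expected_value_LeafX (X Y : Type) (L : X -> R) x (y : Y) :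
  expected_value (LeafX L) x y = L x.
Proof. by rewrite /expected_value /= big_seq1 mul1r. Qed.

Lemma expected_value_LeafY (X Y : Type) (L : Y -> R) (x : X) y :
  expected_value (LeafY L) x y = L y.
Proof. by rewrite /expected_value /= big_seq1 mul1r. Qed.

Lemma branching_ge0 (Z : Type) (p0 p1 : Z -> R) z :
  branching p0 p1 -> 0 <= p0 z /\ 0 <= p1 z.
Proof. by move=> /(_ z)[/andP[-> _] /andP[-> _]]. Qed.

(** A leaf is a single product with one factor constantly 1. A node joins the index sets of its
    children and scales [T] or [U], according to its type, by the branching probabilities. *)
Lemma protocol_factorization (X Y : Type) (t : protocol R X Y) :
  protocol_wf t ->
  exists k (T : 'I_k -> X -> R) (U : 'I_k -> Y -> R),
    [/\ (k <= 2 ^ height t)%N, forall l x, 0 <= T l x, forall l y, 0 <= U l y &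
        forall x y, expected_value t x y = \sum_l T l x * U l y].
Proof.
elim: t => [L|L|p0 p1 l IHl r IHr|q0 q1 l IHl r IHr] /=.
- exists 1%N, (fun=> L), (fun _ _ => 1); split=> // x y.
  by rewrite big_ord1 mulr1 expected_value_LeafX.
- exists 1%N, (fun _ _ => 1), (fun=> L); split=> // x y.
  by rewrite big_ord1 mul1r expected_value_LeafY.
- move=> [p01 /IHl[k [T [U [kh T0 U0 lE]]]] /IHr[k' [T' [U' [kh' T'0 U'0 rE]]]]].
  exists (k + k')%N, (fun i x => match fintype.split i with
    inl j => p0 x * T j x | inr j => p1 x * T' j x end),
    (fun i y => match fintype.split i with inl j => U j y | inr j => U' j y end).
  split=> [|i x|i y|x y].
  + exact: leq_add_exp2.
  + by have [? ?] := branching_ge0 x p01;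
    case: fintype.split => j; exact: mulr_ge0.
  + by case: fintype.split.
  rewrite expected_value_NodeX lE rE big_split_ord !mulr_sumr /=.
  congr (_ + _); apply: eq_bigr => i _.
    by rewrite (unsplitK (inl _ i)) mulrA.
  by rewrite (unsplitK (inr _ i)) mulrA.
- move=> [q01 /IHl[k [T [U [kh T0 U0 lE]]]] /IHr[k' [T' [U' [kh' T'0 U'0 rE]]]]].
  exists (k + k')%N,
    (fun i x => match fintype.split i with inl j => T j x | inr j => T' j x end),
    (fun i y => match fintype.split i with
    inl j => q0 y * U j y | inr j => q1 y * U' j y end).
  split=> [|i x|i y|x y].
  + exact: leq_add_exp2.
  + by case: fintype.split.
  + by have [? ?] := branching_ge0 y q01;
    case: fintype.split => j; exact: mulr_ge0.
  rewrite expected_value_NodeY lE rE big_split_ord !mulr_sumr /=.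
  congr (_ + _); apply: eq_bigr => i _.
    by rewrite (unsplitK (inl _ i)) mulrCA.
  by rewrite (unsplitK (inr _ i)) mulrCA.
Qed.

Lemma computes_factorization m n (S : 'M[R]_(m, n)) t : computes t S ->
  exists2 k, nonneg_factorization S k & (k <= 2 ^ height t)%N.
Proof.
move=> [/protocol_factorization[k [T [U [kt T0 U0 tE]]]] tS]; exists k => //.
exists (\matrix_(i, l) T l i), (\matrix_(l, j) U l j).
split=> [i l|l j|]; rewrite ?mxE//; apply/matrixP => i j.
by rewrite -tS tE mxE; apply: eq_bigr => l _; rewrite !mxE.
Qed.

(* Conditioned on the path reaching the root of [t], leaf [l] is reached with
   probability proportional to [T l x]. *)
Lemma conditional_protocol (X Y : Type) (T : nat -> X -> R) (U : nat -> Y -> R)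
    c a b :
  (forall l x, 0 <= T l x) -> (forall l y, 0 <= U l y) -> (b - a <= 2 ^ c)%N ->
  exists t : protocol R X Y, [/\ protocol_wf t, (height t <= c)%N &
    forall x y, (\sum_(a <= l < b) T l x) * expected_value t x y =
      \sum_(a <= l < b) T l x * U l y].
Proof.
move=> T0 U0; elim: c a b => [|c IHc] a b ab.
  exists (LeafY (U a)); split=> //= x y; rewrite expected_value_LeafY.
  have [ba|ltab] := leqP b a; first by rewrite !big_geq// mul0r.
  have -> : b = a.+1 by move: ab; lia.
  by rewrite !big_nat1.
have [ba|ltab] := leqP b a.
  exists (LeafY (fun=> 0)); split=> //= x y.
  by rewrite !big_geq// mul0r.
(* The left half is filled up to [2 ^ c] indices, which leaves at most [2 ^ c] for the right
   half. *)
pose k := minn b (a + 2 ^ c).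
have ak : (a <= k)%N by rewrite leq_min ltnW//= leq_addr.
have kb : (k <= b)%N by rewrite geq_minl.
have [|tl [wl hl lE]] := IHc a k; first by rewrite leq_subLR geq_minr.
have [|tr [wr hr rE]] := IHc k b.
  by move: ab; rewrite /k expnS; lia.
pose A x := \sum_(a <= l < k) T l x; pose B x := \sum_(k <= l < b) T l x.
have A0 x : 0 <= A x by exact: sumr_ge0.
have B0 x : 0 <= B x by exact: sumr_ge0.
(* Where [A x + B x = 0], division by zero gives 0: the path stops here, and the required identity
   reads [0 = 0]. *)
exists (NodeX (fun x => A x / (A x + B x)) (fun x => B x / (A x + B x)) tl tr).
split=> [|/=|x y].
- split=> // x; have [AB|AB] := eqVneq (A x + B x) 0.
    by rewrite AB invr0 !mulr0 addr0 lexx ler01.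
  have AB0 : 0 < A x + B x by rewrite lt_neqAle eq_sym AB addr_ge0.
  rewrite !ler_pdivrMr// !divr_ge0 ?(ltW AB0)// !mul1r -mulrDl divff//.
  by rewrite lerDl lerDr A0 B0.
- by rewrite ltnS geq_max hl hr.
rewrite expected_value_NodeX !(big_cat_nat ak kb)/= -lE -rE -/(A x) -/(B x).
have [/eqP|AB] := eqVneq (A x + B x) 0; last by field.
by rewrite paddr_eq0// => /andP[/eqP-> /eqP->]; rewrite !mul0r addr0 mul0r.
Qed.

(** Unlike the nodes below it, the root branches with the unconditional masses of its two halves.
    Their sum may be less than 1, and the path stops at the root with the remaining probability;
    hence the height bound [c.+1]. *)
Lemma factorization_protocol m n (S : 'M[R]_(m, n)) k c :
  nonneg_factorization S k -> (k <= 2 ^ c.+1)%N ->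
  exists2 t : protocol R 'I_m 'I_n, computes t S & (height t <= c.+1)%N.
Proof.
move=> [T [U [T0 U0 STU]]] kc.
(* [M] exceeds every row sum of [T], and the 1 keeps it positive. Below, [T] is divided and [U]
   multiplied by [M], both extended by 0 to all natural indices. *)
pose M := 1 + \sum_i \sum_l T i l.
have M1 : 1 <= M by rewrite lerDl; do 2![apply: sumr_ge0 => ? _].
have M0 : 0 < M by exact: lt_le_trans M1.
pose T' l i := if insub l is Some l' then T i l' / M else 0.
pose U' l j := if insub l is Some l' then M * U l' j else 0.
have T'0 l i : 0 <= T' l i.
  by rewrite /T'; case: insub => // l'; rewrite divr_ge0// ltW.
have U'0 l j : 0 <= U' l j.
  by rewrite /U'; case: insub => // l'; rewrite mulr_ge0// ltW.
have T'1 i : \sum_(0 <= l < k) T' l i <= 1.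
  rewrite big_mkord.
  under eq_bigr => l _ do rewrite /T' valK.
  rewrite -mulr_suml ler_pdivrMr// mul1r /M (bigD1 i)//=.
  rewrite addrCA lerDl addr_ge0//; do 2![apply: sumr_ge0 => ? _] => //.
have S' i j : S i j = \sum_(0 <= l < k) T' l i * U' l j.
  rewrite STU mxE big_mkord; apply: eq_bigr => l _.
  by rewrite /T' /U' valK mulrA divfK// gt_eqF.
pose h := minn k (2 ^ c).
have hk : (h <= k)%N by rewrite geq_minl.
have [|tl [wl hl lE]] := @conditional_protocol _ _ _ _ c 0 h T'0 U'0.
  by rewrite subn0 geq_minr.
have [|tr [wr hr rE]] := @conditional_protocol _ _ _ _ c h k T'0 U'0.
  by move: kc; rewrite /h expnS; lia.
exists (NodeX (fun i => \sum_(0 <= l < h) T' l i)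
              (fun i => \sum_(h <= l < k) T' l i) tl tr); last first.
  by rewrite /= ltnS geq_max hl hr.
split=> [|i j]; last first.
  by rewrite expected_value_NodeX lE rE S' (big_cat_nat (leq0n _) hk).
split=> // i; have := T'1 i; rewrite (big_cat_nat (leq0n _) hk)/= => hT.
have h0 : 0 <= \sum_(0 <= l < h) T' l i by exact: sumr_ge0.
have h1 : 0 <= \sum_(h <= l < k) T' l i by exact: sumr_ge0.
by rewrite h0 h1; split=> //; lra.
Qed.

End protocols.

(** * Rounded-up base-2 logarithms of natural numbers *)

Section logarithm.
Context {R : realType}.

Lemma lg_pow2 c : lg ((2 ^ c)%:R : R) = c%:R.
Proof.
have ln2 : ln 2 != 0 :> R by rewrite gt_eqF// ln_gt0// ltr1n.
by rewrite /lg natrX lnXn// -[_ *+ c]mulr_natl mulfK.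
Qed.

Lemma ler_lg : {in Num.pos &, {mono @lg R : x y / x <= y}}.
Proof.
move=> x y x0 y0; rewrite /lg ler_pM2r ?ler_ln//.
by rewrite invr_gt0 ln_gt0// ltr1n.
Qed.

(** By monotonicity of [lg] for [r > 0]; at [r = 0] the default [ln 0 = 0] makes both sides true. *)
Lemma ceil_lg_le r c : (Num.ceil (lg (r%:R : R)) <= c%:Z) = (r <= 2 ^ c)%N.
Proof.
rewrite ceil_le_int -pmulrn -(lg_pow2 c); case: r => [|r].
  by rewrite lg_pow2 /lg ln0// mul0r ler0n.
by rewrite ler_lg ?posrE ?ltr0n ?expn_gt0// ler_nat.
Qed.

Lemma ceil_lg_nat r : exists c : nat, Num.ceil (lg (r%:R : R)) = c%:Z.
Proof.
suff : 0 <= Num.ceil (lg (r%:R : R)).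
  by case: (Num.ceil _) => // c _; exists c.
rewrite ceil_ge0 (lt_le_trans (ltrN10 R))//; case: r => [|r].
  by rewrite /lg ln0// mul0r.
by rewrite -[0](lg_pow2 0) ler_lg ?posrE ?ltr0n ?expn_gt0// ler_nat.
Qed.

End logarithm.

Lemma is_min_exists (A : set nat) k : A k ->
  exists2 r, is_min A r & (r <= k)%N.
Proof.
move=> Ak; have exA : exists j, `[< A j >] by exists k; apply/asboolP.
case: (ex_minnP exA) => r /asboolP Ar rmin.
have {}rmin j : A j -> (r <= j)%N by move=> Aj; apply: rmin; apply/asboolP.
by exists r => //; exact: rmin.
Qed.

Unset Implicit Arguments.

Theorem corollary3 (R : realType) (d : nat) (P : set 'cV[R]_d)
    (hP : polytope P) (hP_nonempty : P !=set0)
    (hP_not_point : ~ exists x, P = [set x])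
    (m n : nat) (S : 'M[R]_(m, n)) (hS : slack_matrix P S) :
  [/\ forall c : nat,
        (exists2 t : protocol R 'I_m 'I_n, computes t S & height t = c) ->
        exists2 r : nat, is_xc P r & (r <= 2 ^ c)%N,
      forall r : nat, is_xc P r ->
        exists2 t : protocol R 'I_m 'I_n, computes t S &
          (height t)%:Z <= Num.ceil (lg (r%:R : R))
    & exists r c : nat,
        [/\ is_xc P r, is_cmin S c & c%:Z = Num.ceil (lg (r%:R : R))]].
Proof.
have xc_le c : (exists2 t : protocol R 'I_m 'I_n, computes t S & height t = c) ->
    exists2 r : nat, is_xc P r & (r <= 2 ^ c)%N.
  move=> [t /computes_factorization[k Sk kt] <-].
  have [r' Pr' r'k] := factorization_extension hP hP_nonempty hS Sk.
  have [r Pr rr'] := is_min_exists Pr'; exists r => //.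
  exact: leq_trans rr' (leq_trans r'k kt).
have S0_protocol : S = 0 ->
    exists2 t : protocol R 'I_m 'I_n, computes t S & height t = 0%N.
  move=> ->; exists (LeafX (fun=> 0)) => //; split=> //= i j.
  by rewrite expected_value_LeafX mxE.
have protocol_le r : is_xc P r ->
    exists2 t : protocol R 'I_m 'I_n, computes t S &
      (height t)%:Z <= Num.ceil (lg (r%:R : R)).
  move=> [Pr _]; have Sr := extension_factorization hP_nonempty hS Pr.
  have [c cE] := @ceil_lg_nat R r; rewrite cE.
  have rc : (r <= 2 ^ c)%N by rewrite -(@ceil_lg_le R) cE.
  (* A zero matrix is computed by a single leaf. Otherwise [r > 1]: inner dimension 0 gives an empty
     sum, and inner dimension 1 is excluded because [P] is not a point. Then [r <= 2 ^ c] forces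
     [c > 0], as a branching root needs. *)
  have [S0|S0] := pselect (S = 0).
    by have [t tS t0] := S0_protocol S0; exists t; rewrite ?t0.
  have r1 : (1 < r)%N.
    case: r Sr {Pr cE rc} => [|[|//]] Sr; exfalso; apply: S0.
      case: Sr => T [U [_ _ ->]]; apply/matrixP => i j.
      by rewrite !mxE big_ord0.
    exact: factorization1_slack0 hS Sr.
  case: c {cE} rc => [|c] rc; first by move: r1 rc; case: r {Sr Pr} => [|[]].
  by have [t tS tc] := factorization_protocol Sr rc; exists t.
split=> //.
have S_ge0 i j : 0 <= S i j.
  have [h [v [hF _ _ vP ->]]] := hS; rewrite mxE; apply: (hF i).1.
  have [h' _ hE] : vertex P (v j) by apply/vP; exists j.
  suff : tight_set P h' (v j) by case.
  by rewrite -hE.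
(* The trivial factorization through the identity shows that some protocol computes [S], so the
   minimum complexity exists. *)
have Sm : nonneg_factorization S m.
  by exists 1%:M, S; split=> [i l|//|]; rewrite ?mul1mx// mxE ler0n.
have [t tS _] : exists2 t : protocol R 'I_m 'I_n, computes t S &
    (height t <= m.+1)%N.
  by apply: factorization_protocol Sm _; rewrite ltnW// ltnW// ltn_expl.
have [c cmin _] : exists2 c, is_cmin S c & (c <= height t)%N.
  by apply: is_min_exists; exists t.
have [r xcr rc] := xc_le c cmin.1; exists r, c; split=> //.
(* One inequality is [r <= 2 ^ c]; the other is the minimality of [c] against the protocol obtained
   from [r]. *)
apply/le_anti; rewrite ceil_lg_le rc andbT.
have [t' t'S] := protocol_le r xcr; apply: le_trans; rewrite lez_nat.
by apply: cmin.2; exists t'.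
Qed.
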